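(* Let $u:A\rightarrow B$ be a ring morphism. The following are equivalent: (i) $u$ is a PSI-morphism. (ii) For every $P\in \mathrm{Spec}(A)$, the fiber ring $k_A(P)\otimes_A B$ is a field or the zero ring. (iii) The ring extension $u(A)\subseteq B$ is a PSI-extension.
   Context: All rings are commutative and unitary, and ring morphisms are unitary. For a ring morphism $u:A\to B$, a proper ideal $I$ of $B$ is called $A$-prime if $u(a)b\in I$ with $a\in A$ and $b\in B$ implies that $u(a)\in I$ or $b\in I$. The morphism $u$ is a PSI-morphism if every $A$-prime ideal of $B$ is a prime ideal of $B$. A ring extension $C\subseteq D$ is a PSI-extension if the inclusion map $C\hookrightarrow D$ is a PSI-morphism. For $P\in\mathrm{Spec}(A)$, $k_A(P)=A_P/PA_P$ is the residue field of $A$ at $P$, and $k_A(P)\otimes_A B$ is the fiber ring of $u$ at $P$. *)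

(* Defs.v *)
From HB Require Import structures.
From mathcomp Require Import all_boot all_algebra.
From mathcomp Require Import boolp classical_sets.
From mathcomp Require Import ring.

Set Implicit Arguments.
Unset Strict Implicit.
Unset Printing Implicit Defensive.

Import GRing.Theory.
Local Open Scope ring_scope.
Local Open Scope quotient_scope.

(* Rings are [comPzRingType]s: commutative, unitary, possibly the zero ring.
   The ideals of ring_quotient.v require a nonzero ring, so the notions below
   are stated anew for arbitrary commutative rings. *)

Section Ideals.
Variable R : comPzRingType.
Implicit Type I : set R.

Definition ideal I : Prop :=
  I 0 /\ forall a x y, I x -> I y -> I (a * x + y).

Definition proper_ideal I : Prop := ideal I /\ ~ I 1.

Definition prime_ideal I : Prop :=
  proper_ideal I /\ forall x y, I (x * y) -> I x \/ I y.

Definition is_zero_ring : Prop := (1 : R) = 0.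

Definition is_field : Prop :=
  (1 : R) <> 0 /\ forall x : R, x <> 0 -> exists y, x * y = 1.

End Ideals.

Arguments is_zero_ring : clear implicits.
Arguments is_field : clear implicits.

Record Spec (A : comPzRingType) := PrimeIdeal {
  prime_set :> set A;
  prime_setP : prime_ideal prime_set
}.

Section PSI.
Variables A B : comPzRingType.
Implicit Type u : {rmorphism A -> B}.

Definition A_prime u (I : set B) : Prop :=
  proper_ideal I /\ forall a b, I (u a * b) -> I (u a) \/ I b.

Definition PSI_morphism u : Prop :=
  forall I : set B, A_prime u I -> prime_ideal I.

End PSI.

Section SubringType.
Variables (D : comPzRingType) (C : subringClosed D).

Record subring_type := SubringElt {
  subring_val : D;
  subring_valP : subring_val \in C
}.

HB.instance Definition _ := [isSub for subring_val].
HB.instance Definition _ := [Choice of subring_type by <:].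
HB.instance Definition _ :=
  GRing.SubChoice_isSubComPzRing.Build D _ subring_type (subringClosedP C).

Definition subring_incl : {rmorphism subring_type -> D} := \val.

Definition PSI_extension : Prop := PSI_morphism subring_incl.

End SubringType.

Section Image.
Variables (A B : comPzRingType) (u : {rmorphism A -> B}).

Definition rimage : pred B := [pred b | `[< exists a, u a = b >]].

Lemma rimage_subring_closed : subring_closed rimage.
Proof.
split; first by apply/asboolP; exists 1; rewrite rmorph1.
- move=> _ _ /asboolP[a <-] /asboolP[b <-]; apply/asboolP.
  by exists (a - b); rewrite rmorphB.
- move=> _ _ /asboolP[a <-] /asboolP[b <-]; apply/asboolP.
  by exists (a * b); rewrite rmorphM.
Qed.

HB.instance Definition _ :=
  GRing.isSubringClosed.Build B rimage rimage_subring_closed.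

Definition image_subring : subringClosed B :=
  GRing.SubringClosed.clone B rimage _.

End Image.

Section Localization.
Variables (A : comPzRingType) (P : Spec A).

Lemma notin_prime1 : 1 \notin (P : set A).
Proof. by apply/negP; rewrite in_setE; case: (prime_setP P) => -[_]. Qed.

Lemma notin_primeM (s t : A) :
  s \notin (P : set A) -> t \notin (P : set A) -> s * t \notin (P : set A).
Proof.
move=> /negP sP /negP tP; apply/negP; rewrite in_setE.
by case: (prime_setP P) => _ h /h[]; rewrite -in_setE.
Qed.

Record denom := Denom { den : A; denP : den \notin (P : set A) }.
HB.instance Definition _ := [isSub for den].
HB.instance Definition _ := [Choice of denom by <:].

Definition denom1 : denom := Denom notin_prime1.
Definition denomM (s t : denom) : denom :=
  Denom (notin_primeM (denP s) (denP t)).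

Definition frac := (A * denom)%type.
Implicit Types x y z : frac.

Definition frac_equiv x y : bool :=
  `[< exists t : denom,
        den t * (x.1 * den y.2) = den t * (y.1 * den x.2) >].

Lemma frac_equiv_is_equiv : equiv_class_of frac_equiv.
Proof.
split=> [x|x y|y x z]; first by apply/asboolP; exists denom1.
  by apply/asboolP/asboolP => -[t e]; exists t; rewrite e.
move=> /asboolP[s e] /asboolP[t f]; apply/asboolP.
exists (denomM (denomM s t) y.2) => /=.
have -> : den s * den t * den y.2 * (x.1 * den z.2) =
          den t * den z.2 * (den s * (x.1 * den y.2)) by ring.
rewrite e.
have -> : den t * den z.2 * (den s * (y.1 * den x.2)) =
          den s * den x.2 * (den t * (y.1 * den z.2)) by ring.
by rewrite f; ring.
Qed.

Canonical frac_equiv_rel := EquivRelPack frac_equiv_is_equiv.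

Definition localization := {eq_quot frac_equiv}.
HB.instance Definition _ := EqQuotient.on localization.
HB.instance Definition _ := Choice.on localization.


Definition loc_frac : frac -> localization := \pi_localization.

Lemma loc_eqP x y : reflect
  (exists t : denom, den t * (x.1 * den y.2) = den t * (y.1 * den x.2))
  (loc_frac x == loc_frac y).
Proof. by rewrite /loc_frac piE; apply: asboolP. Qed.

Definition frac_add x y : frac := (x.1 * den y.2 + y.1 * den x.2, denomM x.2 y.2).
Definition frac_mul x y : frac := (x.1 * y.1, denomM x.2 y.2).
Definition frac_opp x : frac := (- x.1, x.2).

Definition loc_zero : localization := loc_frac (0, denom1).
Definition loc_one : localization := loc_frac (1, denom1).
Definition loc_add := lift_op2 localization frac_add.
Definition loc_mul := lift_op2 localization frac_mul.
Definition loc_opp := lift_op1 localization frac_opp.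

Lemma loc_addE x y : loc_add (loc_frac x) (loc_frac y) = loc_frac (frac_add x y).
Proof.
rewrite /loc_add -lock /=; apply/eqP/loc_eqP.
have /eqP/loc_eqP[s /= es] : loc_frac (repr (loc_frac x)) = loc_frac x by apply: reprK.
have /eqP/loc_eqP[t /= et] : loc_frac (repr (loc_frac y)) = loc_frac y by apply: reprK.
move: (repr (loc_frac x)) (repr (loc_frac y)) es et => [a p] [b q] /= es et.
exists (denomM s t) => /=.
pose r := den t * den y.2 * den q; pose r' := den s * den x.2 * den p.
transitivity (r * (den s * (a * den x.2)) + r' * (den t * (b * den y.2))).
  by rewrite /r /r'; ring.
by rewrite es et /r /r'; ring.
Qed.

Lemma loc_mulE x y : loc_mul (loc_frac x) (loc_frac y) = loc_frac (frac_mul x y).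
Proof.
rewrite /loc_mul -lock /=; apply/eqP/loc_eqP.
have /eqP/loc_eqP[s /= es] : loc_frac (repr (loc_frac x)) = loc_frac x by apply: reprK.
have /eqP/loc_eqP[t /= et] : loc_frac (repr (loc_frac y)) = loc_frac y by apply: reprK.
move: (repr (loc_frac x)) (repr (loc_frac y)) es et => [a p] [b q] /= es et.
exists (denomM s t) => /=.
transitivity (den s * (a * den x.2) * (den t * (b * den y.2))); first by ring.
by rewrite es et; ring.
Qed.

Lemma loc_oppE x : loc_opp (loc_frac x) = loc_frac (frac_opp x).
Proof.
rewrite /loc_opp -lock /=; apply/eqP/loc_eqP.
have /eqP/loc_eqP[s /= es] : loc_frac (repr (loc_frac x)) = loc_frac x by apply: reprK.
by exists s => /=; rewrite !mulNr !mulrN es.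
Qed.

Lemma loc_fracW (K : localization -> Prop) :
  (forall x, K (loc_frac x)) -> forall w, K w.
Proof. by move=> h w; rewrite -[w]reprK; apply: h. Qed.

Lemma loc_addA : associative loc_add.
Proof.
elim/loc_fracW=> x; elim/loc_fracW=> y; elim/loc_fracW=> z.
by rewrite !loc_addE; apply/eqP/loc_eqP; exists denom1 => /=; ring.
Qed.

Lemma loc_addC : commutative loc_add.
Proof.
elim/loc_fracW=> x; elim/loc_fracW=> y.
by rewrite !loc_addE; apply/eqP/loc_eqP; exists denom1 => /=; ring.
Qed.

Lemma loc_add0 : left_id loc_zero loc_add.
Proof.
elim/loc_fracW=> x.
by rewrite loc_addE; apply/eqP/loc_eqP; exists denom1 => /=; ring.
Qed.

Lemma loc_addN : left_inverse loc_zero loc_opp loc_add.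
Proof.
elim/loc_fracW=> x; rewrite loc_oppE loc_addE.
by apply/eqP/loc_eqP; exists denom1 => /=; ring.
Qed.

HB.instance Definition _ :=
  GRing.isZmodule.Build localization loc_addA loc_addC loc_add0 loc_addN.

Lemma loc_mulA : associative loc_mul.
Proof.
elim/loc_fracW=> x; elim/loc_fracW=> y; elim/loc_fracW=> z.
by rewrite !loc_mulE; apply/eqP/loc_eqP; exists denom1 => /=; ring.
Qed.

Lemma loc_mulC : commutative loc_mul.
Proof.
elim/loc_fracW=> x; elim/loc_fracW=> y.
by rewrite !loc_mulE; apply/eqP/loc_eqP; exists denom1 => /=; ring.
Qed.

Lemma loc_mul1 : left_id loc_one loc_mul.
Proof.
elim/loc_fracW=> x.
by rewrite loc_mulE; apply/eqP/loc_eqP; exists denom1 => /=; ring.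
Qed.

Lemma loc_mulDl : left_distributive loc_mul loc_add.
Proof.
elim/loc_fracW=> x; elim/loc_fracW=> y; elim/loc_fracW=> z.
rewrite !(loc_mulE, loc_addE).
by apply/eqP/loc_eqP; exists denom1 => /=; ring.
Qed.

Lemma prime_set0 : (P : set A) 0.
Proof. by case: (prime_setP P) => -[[]]. Qed.

Lemma loc_oner_neq0 : loc_one != loc_zero.
Proof.
apply/negP=> /loc_eqP[[t tP]] /=; rewrite mul0r mulr0 !mulr1 => t0.
by move/negP: tP; rewrite in_setE t0; apply; apply: prime_set0.
Qed.

HB.instance Definition _ := GRing.Zmodule_isComNzRing.Build localization
  loc_mulA loc_mulC loc_mul1 loc_mulDl loc_oner_neq0.

Definition to_loc (a : A) : localization := loc_frac (a, denom1).

Lemma to_loc_is_zmod_morphism : zmod_morphism to_loc.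
Proof.
move=> a b; rewrite -[RHS]/(loc_add _ (loc_opp _)) loc_oppE loc_addE.
by apply/eqP/loc_eqP; exists denom1 => /=; ring.
Qed.

Lemma to_loc_is_monoid_morphism : monoid_morphism to_loc.
Proof.
split=> // a b; rewrite -[RHS]/(loc_mul _ _) loc_mulE.
by apply/eqP/loc_eqP; exists denom1 => /=; ring.
Qed.

HB.instance Definition _ :=
  GRing.isZmodMorphism.Build A localization to_loc to_loc_is_zmod_morphism.
HB.instance Definition _ :=
  GRing.isMonoidMorphism.Build A localization to_loc to_loc_is_monoid_morphism.

(* The ideal P A_P of A_P: the fractions with a numerator in P. *)
Definition loc_max : pred localization :=
  [pred w | `[< exists (a : A) (s : denom), prime_set P a /\ w = loc_frac (a, s) >]].

Lemma loc_max_idealr_closed : idealr_closed loc_max.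
Proof.
have [[[P0 PD] _] Pp] := prime_setP P.
split.
- by apply/asboolP; exists 0, denom1; split.
- apply/asboolP => -[a [s [Pa /eqP/loc_eqP[t /=]]]].
  rewrite mul1r mulr1 => e.
  have : (P : set A) (den t * den s).
    by rewrite e; have := PD (den t) _ _ Pa P0; rewrite addr0.
  by case/Pp; rewrite -in_setE; apply/negP; apply: denP.
- elim/loc_fracW=> c _ _ /asboolP[a [s [Pa ->]]] /asboolP[b [t [Pb ->]]].
  apply/asboolP.
  exists (frac_add (frac_mul c (a, s)) (b, t)).1, (frac_add (frac_mul c (a, s)) (b, t)).2.
  split; last by rewrite -surjective_pairing -loc_addE -loc_mulE.
  rewrite /=; have -> : c.1 * a * den t + b * (den c.2 * den s) =
    c.1 * den t * a + (den c.2 * den s * b + 0) by ring.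
  by apply: (PD) => //; apply: PD.
Qed.

HB.instance Definition _ :=
  isIdealr.Build localization loc_max loc_max_idealr_closed.

Definition residue_field :=
  {ideal_quot (loc_max : idealr localization)}.
HB.instance Definition _ := GRing.ComNzRing.on residue_field.

Definition to_residue : {rmorphism A -> residue_field} :=
  \pi_residue_field \o to_loc.

End Localization.

Arguments loc_max {A} P _.
Arguments to_loc {A} P a.
Arguments to_residue {A} P.

(* R \otimes_A S for the A-algebras f : A -> R and g : A -> S: a finite sequence
   of pairs (x, y) stands for the sum of the tensors x \otimes y. *)
Section TensorProduct.
Variables (A R S : comPzRingType).
Variables (f : {rmorphism A -> R}) (g : {rmorphism A -> S}).

Definition tsum := seq (R * S).
Implicit Types (l m n : tsum) (p q : R * S).

Inductive tcong : tsum -> tsum -> Prop :=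
| tcong_perm l m of perm_eq l m : tcong l m
| tcong_sym l m of tcong l m : tcong m l
| tcong_trans l m n of tcong l m & tcong m n : tcong l n
| tcong_cat l l' m m' of tcong l l' & tcong m m' : tcong (l ++ m) (l' ++ m')
| tcong_0l y : tcong [:: (0, y)] [::]
| tcong_Dl x x' y : tcong [:: (x + x', y)] [:: (x, y); (x', y)]
| tcong_Dr x y y' : tcong [:: (x, y + y')] [:: (x, y); (x, y')]
| tcong_bal a x y : tcong [:: (f a * x, y)] [:: (x, g a * y)].

Lemma tcong_refl l : tcong l l. Proof. exact: tcong_perm. Qed.
Hint Resolve tcong_refl : core.

Definition tequiv l m : bool := `[< tcong l m >].

Lemma tequiv_is_equiv : equiv_class_of tequiv.
Proof.
split=> [l|l m|m l n]; first exact/asboolP.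
  by apply/asboolP/asboolP; apply: tcong_sym.
by move=> /asboolP h /asboolP k; apply/asboolP; apply: tcong_trans h k.
Qed.

Canonical tequiv_rel := EquivRelPack tequiv_is_equiv.

Definition tensor := {eq_quot tequiv}.
HB.instance Definition _ := EqQuotient.on tensor.
HB.instance Definition _ := Choice.on tensor.

Definition to_tensor : tsum -> tensor := \pi_tensor.

Lemma tensor_eqP l m : reflect (tcong l m) (to_tensor l == to_tensor m).
Proof. by rewrite /to_tensor piE; apply: asboolP. Qed.

Lemma tensor_repr l : tcong (repr (to_tensor l)) l.
Proof. by apply/tensor_eqP; rewrite /to_tensor reprK. Qed.

Definition pmul p q : R * S := (p.1 * q.1, p.2 * q.2).
Definition popp p : R * S := (- p.1, p.2).
Definition tmul l m : tsum := [seq pmul p q | p <- l, q <- m].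
Definition topp l : tsum := map popp l.

Definition tensor_zero : tensor := to_tensor [::].
Definition tensor_one : tensor := to_tensor [:: (1, 1)].
Definition tensor_add := lift_op2 tensor (@cat (R * S)).
Definition tensor_mul := lift_op2 tensor tmul.
Definition tensor_opp := lift_op1 tensor topp.

Lemma tcong_scale p l m : tcong l m -> tcong (map (pmul p) l) (map (pmul p) m).
Proof.
elim=> {l m}.
- by move=> l m lm; apply/tcong_perm/perm_map.
- by move=> l m _; apply: tcong_sym.
- by move=> l m n _ h _; apply: tcong_trans.
- by move=> l l' m m' _ h _ k; rewrite !map_cat; apply: tcong_cat.
- by move=> y; rewrite /= /pmul /= mulr0; apply: tcong_0l.
- by move=> x x' y; rewrite /= /pmul /= mulrDr; apply: tcong_Dl.
- by move=> x y y'; rewrite /= /pmul /= mulrDr; apply: tcong_Dr.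
- move=> a x y; rewrite /= /pmul /= mulrCA [p.2 * (_ * _)]mulrCA.
  exact: tcong_bal.
Qed.

Lemma tmul_cons p l m : tmul (p :: l) m = map (pmul p) m ++ tmul l m.
Proof. by []. Qed.

Lemma tmul_cat l l' m : tmul (l ++ l') m = tmul l m ++ tmul l' m.
Proof. exact: allpairs_cat. Qed.

Lemma tmulC l m : tcong (tmul l m) (tmul m l).
Proof.
have pmulC p q : pmul p q = pmul q p by rewrite /pmul mulrC [p.2 * _]mulrC.
apply: tcong_perm; elim: l => [|p l IH]; first by elim: m.
rewrite tmul_cons perm_sym perm_sym (permPl (perm_cat (perm_refl _) IH)).
elim: m {IH} => //= q m IH.
rewrite !tmul_cons /= pmulC perm_cons.
by rewrite perm_catCA perm_cat2l.
Qed.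

Lemma tcong_mulr l m m' : tcong m m' -> tcong (tmul l m) (tmul l m').
Proof.
move=> h; elim: l => // p l IH; rewrite !tmul_cons.
by apply: tcong_cat => //; apply: tcong_scale.
Qed.

Lemma tcong_mul l l' m m' :
  tcong l l' -> tcong m m' -> tcong (tmul l m) (tmul l' m').
Proof.
move=> hl hm; apply: (tcong_trans (tcong_mulr _ hm)).
apply: (tcong_trans (tmulC _ _)); apply: tcong_trans (tmulC _ _).
exact: tcong_mulr.
Qed.

Lemma tcong_opp l m : tcong l m -> tcong (topp l) (topp m).
Proof.
have E n : topp n = map (pmul (-1, 1)) n.
  by apply: eq_map => -[x y]; rewrite /pmul /popp /= mulN1r mul1r.
by rewrite !E; apply: tcong_scale.
Qed.

Lemma tensor_addE l m :
  tensor_add (to_tensor l) (to_tensor m) = to_tensor (l ++ m).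
Proof.
rewrite /tensor_add -lock /=; apply/eqP/tensor_eqP.
by apply: tcong_cat; apply: tensor_repr.
Qed.

Lemma tensor_mulE l m :
  tensor_mul (to_tensor l) (to_tensor m) = to_tensor (tmul l m).
Proof.
rewrite /tensor_mul -lock /=; apply/eqP/tensor_eqP.
by apply: tcong_mul; apply: tensor_repr.
Qed.

Lemma tensor_oppE l : tensor_opp (to_tensor l) = to_tensor (topp l).
Proof.
rewrite /tensor_opp -lock /=; apply/eqP/tensor_eqP.
by apply: tcong_opp; apply: tensor_repr.
Qed.

Lemma tensorW (K : tensor -> Prop) :
  (forall l, K (to_tensor l)) -> forall w, K w.
Proof. by move=> h w; rewrite -[w]reprK; apply: h. Qed.

Lemma tensor_addA : associative tensor_add.
Proof.
elim/tensorW=> l; elim/tensorW=> m; elim/tensorW=> n.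
by rewrite !tensor_addE catA.
Qed.

Lemma tensor_addC : commutative tensor_add.
Proof.
elim/tensorW=> l; elim/tensorW=> m; rewrite !tensor_addE.
by apply/eqP/tensor_eqP/tcong_perm; rewrite perm_catC.
Qed.

Lemma tensor_add0 : left_id tensor_zero tensor_add.
Proof. by elim/tensorW=> l; rewrite tensor_addE. Qed.

Lemma tensor_addN : left_inverse tensor_zero tensor_opp tensor_add.
Proof.
elim/tensorW=> l; rewrite tensor_oppE tensor_addE; apply/eqP/tensor_eqP.
elim: l => //= -[x y] l IH.
apply: (@tcong_trans _ ([:: (- x, y); (x, y)] ++ (topp l ++ l))).
  by apply: tcong_perm; rewrite /= perm_cons perm_catC /= perm_cons perm_catC.
rewrite -[[::]]/([::] ++ [::]); apply: tcong_cat IH.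
apply: tcong_trans (tcong_0l y); rewrite -(addNr x).
exact/tcong_sym/tcong_Dl.
Qed.

HB.instance Definition _ := GRing.isZmodule.Build tensor
  tensor_addA tensor_addC tensor_add0 tensor_addN.

Lemma tensor_mulA : associative tensor_mul.
Proof.
elim/tensorW=> l; elim/tensorW=> m; elim/tensorW=> n.
rewrite !tensor_mulE; congr to_tensor.
elim: l => // p l IH; rewrite !tmul_cons tmul_cat IH; congr (_ ++ _).
elim: m {IH} => // q m IH; rewrite !tmul_cons map_cat IH; congr (_ ++ _).
by rewrite -map_comp; apply: eq_map => r; rewrite /= /pmul /= !mulrA.
Qed.

Lemma tensor_mulC : commutative tensor_mul.
Proof.
elim/tensorW=> l; elim/tensorW=> m; rewrite !tensor_mulE.
exact/eqP/tensor_eqP/tmulC.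
Qed.

Lemma tensor_mul1 : left_id tensor_one tensor_mul.
Proof.
elim/tensorW=> l; rewrite tensor_mulE; congr to_tensor.
by rewrite tmul_cons cats0 map_id_in // => -[x y] _; rewrite /pmul !mul1r.
Qed.

Lemma tensor_mulDl : left_distributive tensor_mul tensor_add.
Proof.
elim/tensorW=> l; elim/tensorW=> m; elim/tensorW=> n.
by rewrite !(tensor_mulE, tensor_addE) tmul_cat.
Qed.

HB.instance Definition _ := GRing.Zmodule_isComPzRing.Build tensor
  tensor_mulA tensor_mulC tensor_mul1 tensor_mulDl.

End TensorProduct.

Definition fiber_ring (A B : comPzRingType) (u : {rmorphism A -> B})
  (P : Spec A) : comPzRingType := tensor (to_residue P) u.

(* Main.v *)
From HB Require Import structures.
From mathcomp Require Import all_boot all_algebra.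
From mathcomp Require Import boolp classical_sets.
From mathcomp Require Import ring.
Require Import Defs.

(** Write [F] for the fiber ring at a prime [P], and [to_fiber : B -> F] for
    the map sending [b] to [1 (x) b]. The two conditions of the theorem are
    related through ideals, by contraction along [to_fiber]. Two facts about
    [F] carry the proof, the halves of the description of [F] as the
    localization of [B / P B] at the image of [A \ P]:
    - every [w] in [F] is a fraction: [to_fiber (u s) * w = to_fiber b] for
      some [s] outside [P] and some [b] ([fiber_frac]), where
      [to_fiber (u s)] is invertible ([to_fiber_unit]);
    - if [I] is an ideal of [B] that contains [u P] and from which the elements
      [u s] with [s] outside [P] can be cancelled, then [to_fiber b = 0] forces
      [b] into [I] ([to_fiber_eq0_mem]).

    If [u] is a PSI-morphism: the elements of [A] map to [F] either to zero or
    to units, so every proper ideal of [F] contracts to an [A]-prime ideal of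
    [B] ([fiber_ideal_contraction]), which is then prime. As all elements of [F]
    are fractions, the ideal of [F] itself is prime. A ring all of whose proper
    ideals are prime is a field or zero
    ([field_or_zero_of_proper_ideals_prime]).

    Conversely, let [I] be [A]-prime. Its preimage [P] in [A] is prime, and [I]
    satisfies the conditions of [to_fiber_eq0_mem] for this [P]. Hence [F] is
    not zero, so it is a field. If [x] is not in [I], then [to_fiber x] is not
    zero; writing its inverse as a fraction [b / s] shows that [u s - x b] lies
    in [I]. Multiplying by [y] with [x y] in [I] gives [u s * y] in [I], so [y]
    is in [I] ([PSI_of_fibers]).

    Finally, being [A]-prime only depends on the elements [u a], that is, on the
    image of [u] ([A_prime_image]), which handles the extension by [u(A)]. *)

Set Implicit Arguments.
Unset Strict Implicit.
Unset Printing Implicit Defensive.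

Import GRing.Theory.
Local Open Scope ring_scope.
Local Open Scope quotient_scope.
Local Open Scope classical_set_scope.

(** * Ideals *)

Section IdealFacts.
Variables (R : comPzRingType) (I : set R).
Hypothesis idI : ideal I.

Lemma ideal0 : I 0. Proof. by case: idI. Qed.

Lemma idealD x y : I x -> I y -> I (x + y).
Proof. by move=> Ix; rewrite -[x]mul1r; case: idI => _; apply. Qed.

Lemma idealMl a x : I x -> I (a * x).
Proof. by move=> Ix; rewrite -[_ * _]addr0; case: idI => I0; apply. Qed.

Lemma idealMr a x : I x -> I (x * a).
Proof. by rewrite mulrC; apply: idealMl. Qed.

Lemma idealN x : I x -> I (- x).
Proof. by rewrite -mulN1r; apply: idealMl. Qed.

Lemma idealB x y : I x -> I y -> I (x - y).
Proof. by move=> Ix Iy; apply/idealD/idealN. Qed.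

Lemma ideal_sum (T : eqType) (s : seq T) (F : T -> R) :
  (forall i, i \in s -> I (F i)) -> I (\sum_(i <- s) F i).
Proof.
by move=> IF; rewrite big_seq; apply: big_ind => //; [apply: ideal0|apply: idealD].
Qed.

Lemma ideal_cancel x y : x * y = 1 -> forall z, I (x * z) -> I z.
Proof.
move=> xy1 z /(idealMl y); rewrite mulrA [y * x]mulrC xy1.
by rewrite mul1r.
Qed.

End IdealFacts.

Lemma ideal_principal (R : comPzRingType) (x : R) :
  ideal [set y | exists z, y = x * z].
Proof.
split; first by exists 0; rewrite mulr0.
by move=> a _ _ [y ->] [z ->]; exists (a * y + z); ring.
Qed.

(** The zero ideal is prime, so the ring is a domain. For nonzero [x], either
    [x^2] is a unit or [(x^2)] is prime; in the second case [x = x^2 y], and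
    cancelling [x] inverts it. *)
Lemma field_or_zero_of_proper_ideals_prime (R : comPzRingType) :
  (forall J : set R, proper_ideal J -> prime_ideal J) ->
  is_field R \/ is_zero_ring R.
Proof.
move=> allprime; have [|R1] := pselect (is_zero_ring R); [by right|left].
have [|_ dom] := allprime [set z : R | z = 0].
  by split; [split=> //= a _ _ -> ->; rewrite mulr0 addr0|exact: R1].
split=> // x x0.
have [[y e]|nx] := pselect (exists y, 1 = x * x * y).
  by exists (x * y); rewrite mulrA -e.
have [_ /(_ x x) xJ] := allprime _ (conj (ideal_principal (x * x)) nx).
have [y e] : exists y, x = x * x * y.
  by case: xJ => [|//|//]; exists 1; rewrite mulr1.
have /dom[//|/eqP] : [set z : R | z = 0] (x * (1 - x * y)).
  by rewrite /= mulrBr mulr1 mulrA -e subrr.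
by rewrite subr_eq0 => /eqP e1; exists y.
Qed.

(** * The residue field at a prime *)

Section ResidueField.
Variables (A : comPzRingType) (P : Spec A).
Local Notation k := (residue_field P).
Local Notation kappa := (@to_residue A P).

Let idP : ideal (prime_set P). Proof. by case: (prime_setP P) => -[]. Qed.

Lemma notin_primeP s : s \notin prime_set P <-> ~ prime_set P s.
Proof. by split=> [/negP|sP]; [|apply/negP]; rewrite in_setE. Qed.

Lemma prime_cancel (s a : A) : ~ prime_set P s -> prime_set P (s * a) -> prime_set P a.
Proof. by case: (prime_setP P) => _ h Ps /h[]. Qed.

Lemma to_residue_eq0 a : kappa a = 0 <-> prime_set P a.
Proof.
have E : (to_loc P a \in loc_max P) = (kappa a == 0).
  have := Quotient.idealrBE (loc_max P : idealr (localization P)) (to_loc P a) 0.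
  by rewrite subr0 => ->; rewrite -(rmorph0 (\pi_(residue_field P))).
split=> [/eqP|Pa]; last first.
  by apply/eqP; rewrite -E; apply/asboolP; exists a, (denom1 P).
rewrite -E => /asboolP[c [s [Pc /eqP/loc_eqP[t]]]].
rewrite /= mulr1 => e; apply: (@prime_cancel (den t * den s)).
  by apply/notin_primeP/notin_primeM; apply: denP.
by rewrite -mulrA [den s * a]mulrC e; apply: idealMl.
Qed.

Lemma to_residue_frac (r : k) :
  exists s a, ~ prime_set P s /\ kappa a = r * kappa s.
Proof.
rewrite -[r]reprK; elim/loc_fracW: (repr r) => -[a s].
exists (den s), a; split; first exact/notin_primeP/denP.
rewrite /to_residue /= -rmorphM; congr (\pi _).
rewrite -[RHS]/(loc_mul _ _) loc_mulE; apply/eqP/loc_eqP.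
by exists (denom1 P) => /=; ring.
Qed.

Lemma to_residue_unit s : ~ prime_set P s -> exists r, kappa s * r = 1.
Proof.
move=> /notin_primeP sP.
exists (\pi_(residue_field P) (loc_frac (1, Denom sP))).
rewrite /to_residue /= -rmorphM -(rmorph1 (\pi_(residue_field P))); congr (\pi _).
rewrite -[LHS]/(loc_mul _ _) loc_mulE; apply/eqP/loc_eqP.
by exists (denom1 P) => /=; ring.
Qed.

(** The numerators are given by a function of the scalar alone, so that they
    can be summed over any list of tensors whose scalars occur in [rs]. *)
Lemma common_denominator (rs : seq k) :
  exists2 s, ~ prime_set P s &
    exists alpha : k -> A, forall r, r \in rs -> kappa (alpha r) = r * kappa s.
Proof.
suff [s sP h] : exists2 s, ~ prime_set P s &
    forall r, exists a, r \in rs -> kappa a = r * kappa s.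
  by exists s => //; have [alpha] := choice h; exists alpha.
elim: rs => [|q rs [t tP IH]].
  exists 1; first by case: (prime_setP P) => -[].
  by move=> r; exists 0.
have [s [c [sP cE]]] := to_residue_frac q.
exists (s * t) => [|r]; first by move/(prime_cancel sP).
have [/eqP->|nrq] := boolP (r == q).
  by exists (c * t) => _; rewrite !rmorphM cE -mulrA.
have [a aE] := IH r; exists (s * a).
by rewrite inE (negPf nrq) => /aE e; rewrite !rmorphM e mulrCA.
Qed.

End ResidueField.

(** * Elements of the fiber ring are fractions *)

Section Fiber.
Variables (A B : comPzRingType) (u : {rmorphism A -> B}) (P : Spec A).
Local Notation k := (residue_field P).
Local Notation kappa := (to_residue P).
Local Notation F := (fiber_ring u P).

Definition pure (r : k) (b : B) : F := to_tensor kappa u [:: (r, b)].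

Lemma pureDr r b c : pure r (b + c) = pure r b + pure r c.
Proof.
rewrite -[RHS]/(tensor_add _ _) tensor_addE; apply/eqP/tensor_eqP.
exact: tcong_Dr.
Qed.

Lemma pureM r b q c : pure r b * pure q c = pure (r * q) (b * c).
Proof. by rewrite -[LHS]/(tensor_mul _ _) tensor_mulE. Qed.

(** Scalars coming from [A] move to the other factor; this is how a tensor
    whose scalars have been cleared of denominators becomes pure. *)
Lemma pure_scal a b : pure (kappa a) b = pure 1 (u a * b).
Proof. by apply/eqP/tensor_eqP; rewrite -{1}[kappa a]mulr1; apply: tcong_bal. Qed.

Lemma pure0l b : pure 0 b = 0.
Proof. exact/eqP/tensor_eqP/tcong_0l. Qed.

Definition to_fiber : B -> F := pure 1.

Lemma to_fiber_is_zmod_morphism : zmod_morphism to_fiber.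
Proof.
have to_fiber0 : to_fiber 0 = 0.
  by rewrite -(rmorph0 u) -[u 0]mulr1 /to_fiber -pure_scal rmorph0 pure0l.
move=> b c; apply: (@addIr _ (to_fiber c)); rewrite subrK /to_fiber -pureDr.
by rewrite subrK.
Qed.

Lemma to_fiber_is_monoid_morphism : monoid_morphism to_fiber.
Proof. by split=> // b c; rewrite /to_fiber pureM mulr1. Qed.

HB.instance Definition _ :=
  GRing.isZmodMorphism.Build B F to_fiber to_fiber_is_zmod_morphism.
HB.instance Definition _ :=
  GRing.isMonoidMorphism.Build B F to_fiber to_fiber_is_monoid_morphism.

Lemma to_fiber_eq0 a : prime_set P a -> to_fiber (u a) = 0.
Proof.
move=> /to_residue_eq0 a0.
by rewrite /to_fiber -[u a]mulr1 -pure_scal a0 pure0l.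
Qed.

Lemma to_fiber_unit s : ~ prime_set P s -> exists w, to_fiber (u s) * w = 1.
Proof.
move=> /to_residue_unit[r e]; exists (pure r 1).
by rewrite /to_fiber -[u s]mulr1 -pure_scal pureM e mulr1.
Qed.

(** Each scalar [r] of a tensor is a quotient of elements of [A] by
    [to_residue_frac]; multiplying by the product of the denominators turns the
    tensor into a sum of tensors [kappa a (x) y = 1 (x) u a * y]. *)
Lemma fiber_frac (w : F) :
  exists s b, ~ prime_set P s /\ to_fiber (u s) * w = to_fiber b.
Proof.
elim/tensorW: w => l; elim: l => [|[r y] l [t [b [tP e]]]].
  exists 1, 0; rewrite rmorph0 mulr0; split=> //.
  by case: (prime_setP P) => -[].
have [s [a [sP aE]]] := to_residue_frac r.
exists (s * t), (u (t * a) * y + u s * b).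
split; first by move/(prime_cancel sP).
have -> : to_tensor kappa u ((r, y) :: l) = pure r y + to_tensor kappa u l.
  by rewrite -[RHS]/(tensor_add _ _) tensor_addE.
have ry : to_fiber (u s) * pure r y = to_fiber (u a * y).
  by rewrite /to_fiber -[u s]mulr1 -pure_scal pureM mul1r mulrC -aE pure_scal.
set w := to_tensor kappa u l in e *.
transitivity (to_fiber (u t) * (to_fiber (u s) * pure r y) +
              to_fiber (u s) * (to_fiber (u t) * w)).
  by rewrite !rmorphM /=; ring.
by rewrite ry e -!rmorphM -rmorphD mulrA -rmorphM.
Qed.

End Fiber.

(** * The kernel of the map to the fiber ring *)

Section Clearing.
Variables (A B : comPzRingType) (u : {rmorphism A -> B}) (P : Spec A).
Local Notation k := (residue_field P).
Local Notation kappa := (to_residue P).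
Implicit Types l m : seq (k * B).

(** The function [alpha] gives numerators over the denominator [s] for the
    scalars of [l]. The element [cleared_sum alpha l / s] of the localization of
    [B / P B] is then the image of the tensor represented by [l]; [s] is kept
    apart to avoid constructing that localization. *)
Definition clears (s : A) (alpha : k -> A) l :=
  forall p, p \in l -> kappa (alpha p.1) = p.1 * kappa s.

Definition cleared_sum (alpha : k -> A) l : B :=
  \sum_(p <- l) u (alpha p.1) * p.2.

Variable I : set B.
Hypothesis idI : ideal I.
(* [I] contains [P B], and [B / I] has no torsion outside [P]: thus [B / I]
   embeds in its localization at the image of [A \ P]. *)
Hypothesis PI : forall a, prime_set P a -> I (u a).
Hypothesis satI : forall s b, ~ prime_set P s -> I (u s * b) -> I b.

Lemma ideal_to_residue_eq a c : kappa a = kappa c -> I (u a - u c).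
Proof.
move=> e; rewrite -rmorphB; apply/PI/to_residue_eq0.
by rewrite rmorphB e subrr.
Qed.

(** Two ways of clearing denominators give the same fraction modulo [I],
    because numerators of one scalar agree modulo [P] after cross
    multiplication. *)
Lemma cleared_sum_denominator s alpha t beta l :
  clears s alpha l -> clears t beta l ->
  I (u t * cleared_sum alpha l - u s * cleared_sum beta l).
Proof.
move=> al bl; rewrite /cleared_sum !mulr_sumr -sumrB; apply: ideal_sum => // p pl.
rewrite !mulrA -!rmorphM -mulrBl; apply: (idealMr idI); apply: ideal_to_residue_eq.
by rewrite !rmorphM al // bl // mulrCA [in RHS]mulrCA [kappa t * _]mulrC.
Qed.

(** The tensor relations are respected modulo [I]: this is the well-definedness
    of the map from the tensor product to the localization of [B / I], checked
    on each generating relation. *)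
Lemma cleared_sum_tcong l m : tcong kappa u l m ->
  forall s alpha, ~ prime_set P s -> clears s alpha (l ++ m) ->
  I (cleared_sum alpha l - cleared_sum alpha m).
Proof.
rewrite /cleared_sum; elim=> {l m}.
- move=> l m lm s alpha _ _; rewrite (perm_big _ lm) subrr; exact: ideal0.
- move=> l m _ IH s alpha sP cl; rewrite -opprB; apply: idealN => //.
  by apply: (IH s) => // p; rewrite mem_cat orbC -mem_cat; apply: cl.
- move=> l m n _ IHl _ IHn s alpha sP cl.
  (* [alpha] need not clear the intermediate tensor [m]: pass to a denominator
     [t] common to all three, and cancel it at the end. *)
  have [t tP [beta bE]] := common_denominator [seq p.1 | p <- l ++ m ++ n].
  have cb p : p \in l ++ m ++ n -> kappa (beta p.1) = p.1 * kappa t.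
    by move=> pl; apply/bE/map_f.
  apply: (satI tP).
  have lmI : I (cleared_sum beta l - cleared_sum beta m).
    by apply: (IHl t) => // p pl; apply: cb; rewrite catA mem_cat pl.
  have mnI : I (cleared_sum beta m - cleared_sum beta n).
    by apply: (IHn t) => // p pl; apply: cb; rewrite mem_cat pl orbT.
  have lI : I (u t * cleared_sum alpha l - u s * cleared_sum beta l).
    apply: cleared_sum_denominator => p pl.
      by apply: cl; rewrite mem_cat pl.
    by apply: cb; rewrite mem_cat pl.
  have nI : I (u t * cleared_sum alpha n - u s * cleared_sum beta n).
    apply: cleared_sum_denominator => p pl.
      by apply: cl; rewrite mem_cat pl orbT.
    by apply: cb; rewrite !mem_cat pl !orbT.
  have -> : u t * (cleared_sum alpha l - cleared_sum alpha n) =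
      (u t * cleared_sum alpha l - u s * cleared_sum beta l) -
      (u t * cleared_sum alpha n - u s * cleared_sum beta n) +
      u s * ((cleared_sum beta l - cleared_sum beta m) +
             (cleared_sum beta m - cleared_sum beta n)) by ring.
  by apply: (idealD idI); [apply: idealB|apply: (idealMl idI); apply: idealD].
- move=> l l' m m' _ IHl _ IHm s alpha sP cl; rewrite !big_cat /= opprD addrACA.
  apply: idealD => //; [apply: (IHl s)|apply: (IHm s)] => // p pl.
    by apply: cl; move: pl; rewrite !mem_cat => /orP[->|->]; rewrite ?orbT.
  by apply: cl; move: pl; rewrite !mem_cat => /orP[->|->]; rewrite ?orbT.
- move=> y s alpha sP cl; rewrite big_seq1 big_nil subr0 /=.
  apply: (idealMr idI); apply/PI/to_residue_eq0.
  by rewrite (cl (0, y)) ?mem_head // mul0r.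
- move=> x x' y s alpha sP cl; rewrite !(big_cons, big_nil) !addr0 /=.
  rewrite -mulrDl -mulrBl -rmorphD; apply: (idealMr idI); apply: ideal_to_residue_eq.
  rewrite rmorphD (cl (x + x', y)) ?(cl (x, y)) ?(cl (x', y)) ?mulrDl //;
  by rewrite !inE eqxx ?orbT.
- move=> x y y' s alpha sP cl; rewrite !(big_cons, big_nil) !addr0 /=.
  by rewrite mulrDr subrr; apply: ideal0.
- move=> a x y s alpha sP cl; rewrite !big_seq1 /= mulrA -mulrBl -rmorphM.
  apply: (idealMr idI); apply: ideal_to_residue_eq.
  rewrite rmorphM (cl (kappa a * x, y)) ?(cl (x, u a * y)) ?inE ?eqxx ?orbT //.
  by rewrite -mulrA mulrC.
Qed.

Lemma to_fiber_eq0_mem b : to_fiber u P b = 0 -> I b.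
Proof.
move=> /eqP/tensor_eqP/cleared_sum_tcong/(_ 1 (fun=> 1)).
rewrite /cleared_sum big_seq1 big_nil subr0 /= rmorph1 mul1r; apply.
  by case: (prime_setP P) => -[].
by move=> p; rewrite inE => /eqP -> /=; rewrite mul1r.
Qed.

End Clearing.

(** * PSI-morphisms and fibers *)

Section Equivalences.
Variables (A B : comPzRingType) (u : {rmorphism A -> B}).

Lemma A_prime_contraction (I : set B) :
  A_prime u I -> prime_ideal [set a | I (u a)].
Proof.
move=> [[idI I1] Iu]; split; first split=> /=.
- split=> /=; first by rewrite rmorph0; apply: ideal0.
  by move=> a x y Ix Iy; rewrite rmorphD rmorphM; apply: (idealD idI) => //; apply: idealMl.
- by rewrite rmorph1.
- by move=> x y /=; rewrite rmorphM => /Iu.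
Qed.

(** An element of [A] becomes zero in the fiber ring if it lies in [P], and a
    unit otherwise. *)
Lemma fiber_ideal_contraction (P : Spec A) (J : set (fiber_ring u P)) :
  proper_ideal J -> A_prime u [set b | J (to_fiber u P b)].
Proof.
move=> [idJ J1]; split; first split=> /=.
- split=> /=; first by rewrite rmorph0; apply: ideal0.
  by move=> a x y Jx Jy; rewrite rmorphD rmorphM; apply: (idealD idJ) => //; apply: idealMl.
- by rewrite rmorph1.
- move=> a b /=; have [Pa _|Pa] := pselect (prime_set P a).
    by left; rewrite to_fiber_eq0 //; apply: ideal0.
  have [w e] := to_fiber_unit u Pa.
  by rewrite rmorphM => /(ideal_cancel idJ e); right.
Qed.

(** Primality passes from the contraction back to [J] since elements of the
    fiber ring are fractions, and their denominators are units. *)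
Lemma PSI_fiber_ideal_prime (P : Spec A) (J : set (fiber_ring u P)) :
  PSI_morphism u -> proper_ideal J -> prime_ideal J.
Proof.
move=> psi pJ; split=> // v w Jvw; have idJ := pJ.1.
have [_ cJ] := psi _ (fiber_ideal_contraction pJ).
have [s [b [sP sv]]] := fiber_frac v; have [t [c [tP tw]]] := fiber_frac w.
have [s' es] := to_fiber_unit u sP; have [t' et] := to_fiber_unit u tP.
have /cJ[] : J (to_fiber u P (b * c)).
- by rewrite rmorphM /= -sv -tw mulrACA; apply: idealMl.
- by rewrite /= -sv => /(ideal_cancel idJ es); left.
- by rewrite /= -tw => /(ideal_cancel idJ et); right.
Qed.

(** For [I] an [A]-prime ideal, the fiber at its contraction is nonzero and
    everything in the kernel of [to_fiber] is in [I], so that inverting [x]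
    in the fiber inverts it modulo [I] up to a factor [u s] that can be
    cancelled. *)
Lemma PSI_of_fibers :
  (forall P : Spec A,
    is_field (fiber_ring u P) \/ is_zero_ring (fiber_ring u P)) ->
  PSI_morphism u.
Proof.
move=> fib I Ip; have [[idI I1] Iu] := Ip; split=> // x y Ixy.
pose P := PrimeIdeal (A_prime_contraction Ip).
have kerI b : to_fiber u P b = 0 -> I b.
  by apply: to_fiber_eq0_mem => // s c sP /Iu[].
case: (fib P) => [[_ inv]|F0]; last first.
  by case: I1; apply: kerI; rewrite rmorph1.
have [Ix|Ix] := pselect (I x); [by left|right].
have [w xw] : exists w, to_fiber u P x * w = 1 by apply/inv => /kerI.
have [s [b [sP sw]]] := fiber_frac w.
have Isxb : I (u s - x * b).
  by apply: kerI; rewrite rmorphB rmorphM /= -sw mulrCA xw mulr1 subrr.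
suff: I (u s * y) by move=> /Iu[/sP|].
have -> : u s * y = (u s - x * b) * y + b * (x * y) by ring.
by apply: (idealD idI); [apply: idealMr|apply: idealMl].
Qed.

Lemma A_prime_image (I : set B) :
  A_prime u I <-> A_prime (subring_incl (image_subring u)) I.
Proof.
split=> -[pI Iu]; split=> //.
  by move=> [c cu] b /=; have /asboolP[a <-] := cu; apply: Iu.
move=> a b; have ua : u a \in image_subring u by apply/asboolP; exists a.
exact: (Iu (SubringElt ua)).
Qed.

Lemma PSI_extension_image : PSI_extension (image_subring u) <-> PSI_morphism u.
Proof. by split=> h I /A_prime_image/h. Qed.

End Equivalences.

Theorem theorem2p4 (A B : comPzRingType) (u : {rmorphism A -> B}) :
  [<-> PSI_morphism u;
       forall P : Spec A,
         is_field (fiber_ring u P) \/ is_zero_ring (fiber_ring u P);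
       PSI_extension (image_subring u)].
Proof.
tfae.
- move=> psi P; apply: field_or_zero_of_proper_ideals_prime => J.
  exact: PSI_fiber_ideal_prime.
- by move/PSI_of_fibers/PSI_extension_image.
- by move/PSI_extension_image.
Qed.
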